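(* Let $M_{ijk}:\mathbb{Z}^3\to\mathbb{C}$, $i,j,k\in\{1,2,3\}$, satisfy $|M_{ijk}(\xi)|\le|\xi|$ for all $\xi\in\mathbb{Z}^3$. There exists $\epsilon>0$ such that for every $\psi\in\Phi(2)$ with $\|\psi\|_2<\epsilon$, the system $$v^k(\xi,t)=\psi^k(\xi)e^{-|\xi|^2t}+\int_0^t e^{-|\xi|^2(t-s)}\sum_{q\in\mathbb{Z}^3}M_{ijk}(\xi)\,v^i(q,s)\,v^j(\xi-q,s)\,ds,\qquad \xi\in\mathbb{Z}^3,\ k\in\{1,2,3\},$$ has a global regular solution $v$ with initial condition $\psi$; that is, there is $v=(v^1,v^2,v^3):\mathbb{Z}^3\times[0,\infty)\to\mathbb{C}^3$ which, for every $T>0$, is a solution on $[0,T)$ with initial condition $\psi$ and is smooth on $(0,T)$.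
   Context: Conventions: repeated indices $i,j$ are summed over $\{1,2,3\}$; $|\xi|$ is the Euclidean norm of $\xi\in\mathbb{Z}^3$. $\Phi(2)$ is the space of all $w=(w^1,w^2,w^3):\mathbb{Z}^3\to\mathbb{C}^3$ with $w(0)=0$ and $\|w\|_2:=\max_k\sup_{\xi\ne0}|\xi|^2|w^k(\xi)|<\infty$. A solution on $[0,T)$ with initial condition $\psi\in\Phi(2)$ is a function $v:\mathbb{Z}^3\times[0,T)\to\mathbb{C}^3$, measurable in $t$ for each $\xi$, with $v(\cdot,t)\in\Phi(2)$ for all $t$ and $\sup_{t}\|v(\cdot,t)\|_2<\infty$ (i.e. $v\in L^\infty(0,T;\Phi(2))$), satisfying the displayed integral equation for all $\xi$, $k$ and all $t\in[0,T)$. $v$ is smooth (regular) on $(0,T)$ if its Fourier coefficients decay faster than any polynomial for positive times: for every $\rho\in(0,T)$ and every $N\ge0$, $\sup_{\rho\le t<T}\sup_{\xi\in\mathbb{Z}^3}|\xi|^N|v^k(\xi,t)|<\infty$ for $k=1,2,3$. *)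

(* Defs.v *)
From HB Require Import structures.
From mathcomp Require Import all_boot all_order all_algebra.
From mathcomp Require Import complex.
From mathcomp Require Import all_classical all_reals all_analysis.

Set Implicit Arguments.
Unset Strict Implicit.
Unset Printing Implicit Defensive.

Import Order.TTheory GRing.Theory Num.Theory.
Import numFieldNormedType.Exports.

Local Open Scope classical_set_scope.
Local Open Scope ring_scope.
Local Open Scope complex_scope.

Notation Z3 := 'rV[int]_3.

Section Defs.
Variable R : realType.
Local Notation C := R[i].
Local Notation mu := (@lebesgue_measure R).

Definition enorm (xi : Z3) : R := Num.sqrt (\sum_(j < 3) (xi 0 j)%:~R ^+ 2).

Definition cmod (z : C) : R := complex.Re `|z|.

(** The sum of a real family is that of its positive part minus that of its
    negative part: it is the usual value for absolutely summable families and
    is meaningful only for those. *)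
Definition rsum (I : choiceType) (f : I -> R) : R :=
  fine (\esum_(i in [set: I]) ((EFin \o f)^\+%E i))
  - fine (\esum_(i in [set: I]) ((EFin \o f)^\-%E i)).

Definition csum (I : choiceType) (f : I -> C) : C :=
  rsum (fun x => complex.Re (f x)) +i* rsum (fun x => complex.Im (f x)).

Definition cmeasurable_fun (D : set R) (f : R -> C) : Prop :=
  measurable_fun D (fun x => complex.Re (f x)) /\ measurable_fun D (fun x => complex.Im (f x)).

Definition cintegral (D : set R) (f : R -> C) : C :=
  Rintegral mu D (fun x => complex.Re (f x)) +i* Rintegral mu D (fun x => complex.Im (f x)).

(** [w xi 0 k] is the component $w^k(\xi)$. *)
Definition Phi2_norm (w : Z3 -> 'rV[C]_3) : \bar R :=
  \big[maxe/-oo%E]_(k < 3)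
    ereal_sup [set (enorm xi ^+ 2 * cmod (w xi 0 k))%:E
              | xi in [set xi : Z3 | xi != 0]].

Definition Phi2 (w : Z3 -> 'rV[C]_3) : Prop :=
  w 0 = 0 /\ (Phi2_norm w < +oo)%E.

Definition nonlinearity (M : 'I_3 -> 'I_3 -> 'I_3 -> Z3 -> C)
    (v : Z3 -> R -> 'rV[C]_3) (k : 'I_3) (xi : Z3) (s : R) : C :=
  csum (fun q : Z3 =>
    \sum_(i < 3) \sum_(j < 3) M i j k xi * v q s 0 i * v (xi - q) s 0 j).

(** Only the values of [v xi] on [[0, T)] matter.  By the first three clauses,
    when [M] is the kernel of the theorem ($|M_{ijk}(\xi)| \le |\xi|$), the sum
    over $\mathbb{Z}^3$ is absolutely convergent (its terms are
    $O(|q|^{-2}|\xi-q|^{-2})$ for $q \notin \{0, \xi\}$, and $0$ otherwise),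
    and is bounded and measurable in $s$, so that [csum] and [cintegral] take
    their usual values.  The last clause at [t = 0] is the initial
    condition. *)
Definition solution (M : 'I_3 -> 'I_3 -> 'I_3 -> Z3 -> C)
    (psi : Z3 -> 'rV[C]_3) (T : R) (v : Z3 -> R -> 'rV[C]_3) : Prop :=
  [/\ forall (xi : Z3) (k : 'I_3),
        cmeasurable_fun `[0, T[ (fun t => v xi t 0 k),
      forall t : R, 0 <= t < T -> Phi2 (fun xi => v xi t),
      (ereal_sup [set Phi2_norm (fun xi => v xi t) | t in `[0%R, T[] < +oo)%E
    & forall (xi : Z3) (k : 'I_3) (t : R), 0 <= t < T ->
        v xi t 0 k =
          psi xi 0 k * (expR (- (enorm xi ^+ 2 * t)))%:C
          + cintegral `[0, t] (fun s =>
              (expR (- (enorm xi ^+ 2 * (t - s))))%:C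
              * nonlinearity M v k xi s)].

Definition smooth (T : R) (v : Z3 -> R -> 'rV[C]_3) : Prop :=
  forall (rho : R) (N : nat) (k : 'I_3), 0 < rho < T ->
    (ereal_sup [set ereal_sup [set (enorm xi ^+ N * cmod (v xi t 0%R k))%R%:E
                              | xi in [set: Z3]]
               | t in `[rho, T[] < +oo)%E.

End Defs.

(* Main.v *)
Require Import Defs.
From HB Require Import structures.
From mathcomp Require Import finmap.
From mathcomp Require Import all_boot all_order all_algebra.
From mathcomp Require Import complex.
From mathcomp Require Import all_classical all_reals all_analysis.
From mathcomp Require Import measurable_realfun.
From mathcomp Require Import zify ring lra.

(** The solution is the fixed point of the right-hand side of the integral
    equation in a space whose norm already contains the regularity: fields with
    [|v^k(xi, t)| <= A |xi|^-2 exp(- |xi| t / 2)] for all [t >= 0].  Since the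
    frequencies are lattice points, [|xi| >= 1] for [xi != 0]; this makes the
    exponential factor harmless, by two remarks.

    It is compatible with the quadratic term: by the triangle inequality
    [exp(- |q| s / 2) exp(- |xi - q| s / 2) <= exp(- |xi| s / 2)]
    ([gevrey_weightM]).  It is compatible with the heat semigroup: as
    [|xi| <= |xi|^2], one half of the factor [exp(- |xi|^2 (t - s))] carries
    [exp(- |xi| s / 2)] to [exp(- |xi| t / 2)], and the integral in [s] of the
    other half is at most [2 |xi|^-2] ([heat_weight_transfer], [Rduhamel_le]).

    With these, the bilinear estimate is the classical one in the space of weight
    [|xi|^2]: the sum over the lattice of [|q|^-2 |xi - q|^-2] is [O(|xi|^-1)]
    ([convolution_esum]), the kernel [M] contributes [|xi|], so that the quadratic
    term is bounded, and the time integral restores the factor [|xi|^-2]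
    ([duhamel_gevrey]).  No constant depends on the length of the time interval, so
    that for small data the map is a contraction on all of [[0, +oo)] at once
    ([duhamel_map_bounded],
    [duhamel_mapB_bounded]).

    The fixed point is obtained as the pointwise limit of the Picard iterates,
    which are measurable in time and converge geometrically in the weighted norm
    ([picard_step], [picard_limit_fixed]).  The rapid decay of the coefficients for
    [t >= rho > 0] is then that of [exp(- |xi| rho / 2)] ([bounded_by_smooth]).

    In the formal estimates [|xi|] is replaced by the sup norm [snorm xi] in the
    weights. *)

Set Implicit Arguments.
Unset Strict Implicit.
Unset Printing Implicit Defensive.

Import Order.TTheory GRing.Theory Num.Theory.
Import numFieldNormedType.Exports.

Local Open Scope classical_set_scope.
Local Open Scope ring_scope.
Local Open Scope complex_scope.

(** * The sup norm on the lattice *)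

(** Every estimate below is carried out with this integer-valued norm, which is
    comparable to the Euclidean one ([enorm_ge_snorm], [enorm_le_snorm]): its
    balls are boxes, whose points are easy to count. *)
Definition snorm (q : Z3) : nat := \max_(i < 3) `|q 0%R i|%N.

Lemma le_snorm (q : Z3) i : (`|q 0%R i| <= snorm q)%N.
Proof. exact: (leq_bigmax_cond (F := fun i => `|q 0%R i|%N)). Qed.

Lemma snorm_attained (q : Z3) : exists i, snorm q = `|q 0%R i|%N.
Proof.
have I0 : (0 < #|'I_3|)%N by rewrite card_ord.
have [i qi] := bigop.eq_bigmax (fun i : 'I_3 => `|q 0%R i|%N) I0.
by exists i; exact: qi.
Qed.

Lemma snorm_eq0 (q : Z3) : (snorm q == 0%N) = (q == 0).
Proof.
apply/eqP/eqP => [q0|->]; last first.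
  by have [i ->] := snorm_attained 0; rewrite mxE.
apply/rowP => i; rewrite mxE; apply/eqP; rewrite -absz_eq0 -leqn0.
by apply: leq_trans (le_snorm q i) _; rewrite q0.
Qed.

Lemma snorm_gt0 (q : Z3) : (0 < snorm q)%N = (q != 0).
Proof. by rewrite lt0n snorm_eq0. Qed.

Lemma snormD_le (p q : Z3) : (snorm (p + q) <= snorm p + snorm q)%N.
Proof.
have [i ->] := snorm_attained (p + q); rewrite mxE.
apply: leq_trans (leq_add (le_snorm p i) (le_snorm q i)).
move: (p 0 i) (q 0 i) => a b; lia.
Qed.

Lemma snorm_split (xi q : Z3) : (snorm xi <= snorm q + snorm (xi - q))%N.
Proof. by apply: leq_trans (snormD_le _ _); rewrite addrC subrK. Qed.

(** A translation by [j] in each coordinate maps the box into the cube of side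
    [2 * j + 1] of natural numbers. *)
Lemma size_box j (s : seq Z3) : uniq s -> all (fun q => snorm q <= j)%N s ->
  (size s <= (2 * j).+1 ^ 3)%N.
Proof.
move=> us /allP sj.
pose f (q : Z3) : 'rV['I_(2 * j).+1]_3 := \row_i inord (absz (q 0 i + j%:Z)).
have fi : {in s &, injective f}.
  move=> p q /sj pj /sj qj /rowP pq; apply/rowP => i.
  have := pq i; rewrite !mxE => /(congr1 val) /=.
  have := le_snorm p i; have := le_snorm q i.
  move: (p 0 i) (q 0 i) => a b aj bj.
  rewrite !inordK; first lia; lia.
rewrite -(size_map f).
have /card_uniqP <- : uniq (map f s) by rewrite map_inj_in_uniq.
apply: leq_trans (max_card _) _.
by rewrite card_mx card_ord mul1n.
Qed.

Section comparison.
Variable R : realType.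

Lemma enorm_ge_snorm (q : Z3) : (snorm q)%:R <= enorm R q.
Proof.
have [i ->] := snorm_attained q.
rewrite -[leLHS]ger0_norm// -sqrtr_sqr /enorm ler_wsqrtr// (bigD1 i)//=.
rewrite -[leLHS]addr0 lerD// ?sumr_ge0// => [|j _]; last exact: sqr_ge0.
by rewrite natr_absz intr_norm real_normK ?num_real.
Qed.

Lemma enorm_le_snorm (q : Z3) : enorm R q <= 2 * (snorm q)%:R.
Proof.
rewrite -[leRHS]ger0_norm ?mulr_ge0// -sqrtr_sqr /enorm ler_wsqrtr//.
apply: (@le_trans _ _ (\sum_(j < 3) (snorm q)%:R ^+ 2)).
  apply: ler_sum => i _; rewrite -real_normK ?num_real// lerXn2r ?nnegrE//.
  by rewrite -intr_norm -natr_absz ler_nat le_snorm.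
rewrite sumr_const card_ord exprMn.
by have := sqr_ge0 ((snorm q)%:R : R); lra.
Qed.

End comparison.

(** * The convolution sum over the lattice *)

Lemma esum_scale_le (R : realType) (I : choiceType) (f : I -> R) (c d : R) : 0 <= c ->
  (\esum_(i in [set: I]) (f i)%:E <= d%:E)%E ->
  (\esum_(i in [set: I]) (c * f i)%:E <= (c * d)%:E)%E.
Proof.
move=> c0 fd; apply: ge_ereal_sup => _ [X [finX _]] <-.
rewrite fsbig_finite//= sumEFin lee_fin -mulr_sumr ler_wpM2l//.
rewrite -lee_fin; apply: le_trans fd; apply: esum_ge; exists X => //.
by rewrite fsbig_finite//= sumEFin.
Qed.

Section lattice.
Variable R : realType.

(** Comparison with the telescoping series of general term
    [(r + j - 1)^-1 - (r + j)^-1]. *)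
Lemma telescoping_tail (r : R) J : 0 < r ->
  \sum_(1 <= j < J.+1) (r + j%:R) ^- 2 <= r^-1 - (r + J%:R)^-1.
Proof.
move=> r0; elim: J => [|J IH]; first by rewrite big_geq// addr0 subrr.
rewrite big_nat_recr//=; apply: (le_trans (lerD IH (lexx _))).
have a0 : 0 < r + J%:R by rewrite ltr_wpDr.
rewrite -natr1 addrA; set a := r + J%:R in a0 *.
rewrite -subr_ge0.
have -> : r^-1 - (a + 1)^-1 - (r^-1 - a^-1 + (a + 1) ^- 2) = a^-1 * (a + 1) ^- 2.
  by field; apply/and3P; split; rewrite gt_eqF// ltr_wpDr.
by rewrite mulr_ge0 ?invr_ge0 ?exprn_ge0 ?ltW// ltr_wpDr.
Qed.

Definition radial (r : R) (n : nat) : R := n%:R ^- 2 * (r + n%:R) ^- 2.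

Lemma lef_pVX k (x y : R) : 0 < y -> y <= x -> x ^- k <= y ^- k.
Proof.
move=> y0 yx; have x0 := lt_le_trans y0 yx.
by rewrite lef_pV2 ?posrE ?exprn_gt0// lerXn2r ?nnegrE// ltW.
Qed.

(** A layer-cake bound: [radial r n] is dominated by a sum of weights over the
    integers [j] of [[n, 2 n)], hence, for [q] running over the lattice, by a
    combination of indicator functions of the boxes [snorm q <= j].  There are
    [n] such [j], and for each of them [j < 2 n] costs a factor [8 * 4 = 32]. *)
Lemma radial_layers (r : R) n : 0 < r -> (0 < n)%N ->
  radial r n <= \sum_(n <= j < 2 * n) 32 * (j%:R ^- 3 * (r + j%:R) ^- 2).
Proof.
move=> r0 n0.
have n0' : 0 < n%:R :> R by rewrite ltr0n.
have h0 j : 0 < r + j%:R :> R by rewrite ltr_wpDr.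
apply: (@le_trans _ _ (\sum_(n <= j < 2 * n) (n%:R ^- 3 * (r + n%:R) ^- 2))).
  rewrite sumr_const_nat (_ : (2 * n - n = n)%N); last by lia.
  rewrite -mulr_natl /radial le_eqVlt; apply/orP; left; apply/eqP.
  by field; rewrite !gt_eqF.
rewrite big_seq [leRHS]big_seq; apply: ler_sum => j; rewrite mem_index_iota => /andP[nj jn].
have j0 : 0 < j%:R :> R by rewrite ltr0n; lia.
have jn' : j%:R <= 2 * n%:R :> R by rewrite -natrM ler_nat; lia.
have -> : 32 * (j%:R ^- 3 * (r + j%:R) ^- 2) =
  (j%:R / 2) ^- 3 * ((r + j%:R)/2) ^- 2 :> R by field; rewrite !gt_eqF.
apply: ler_pM.
- by rewrite invr_ge0 exprn_ge0.
- by rewrite invr_ge0 exprn_ge0// ltW.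
- by apply: lef_pVX; rewrite ?divr_gt0// ler_pdivrMr// mulrC.
- apply: lef_pVX; rewrite ?divr_gt0// ler_pdivrMr// mulrC.
  by clear -r0 jn'; lra.
Qed.

(** Once the layers are exchanged with the sum over the points, the box of radius
    [j] contributes its cardinality, at most [27 * j ^ 3], which cancels the
    factor [j ^- 3] of its weight; what remains telescopes.  The constant is
    [864 = 27 * 32]. *)
Lemma radial_sum_seq (r : R) (s : seq Z3) : 0 < r -> uniq s ->
  \sum_(q <- s) radial r (snorm q) <= 864 / r.
Proof.
move=> r0 us.
pose c j : R := 32 * (j%:R ^- 3 * (r + j%:R) ^- 2).
have h0 j : 0 < r + j%:R :> R by rewrite ltr_wpDr.
have c0 j : 0 <= c j by rewrite /c !mulr_ge0 ?invr_ge0 ?exprn_ge0// ltW.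
pose J := (\max_(q <- s) 2 * snorm q)%N.
apply: (@le_trans _ _ (\sum_(q <- s) \sum_(1 <= j < J.+1 | (snorm q <= j)%N) c j)).
  rewrite big_seq [leRHS]big_seq; apply: ler_sum => q qs.
  (* at the origin the radial weight is [0], by the convention [0^-1 = 0] *)
  have [/eqP q0|q0] := posnP (snorm q).
    by rewrite /radial (eqP q0) expr0n/= invr0 mul0r sumr_ge0.
  apply: (le_trans (radial_layers r0 q0)); rewrite big_mkcond/=.
  have qJ : (2 * snorm q <= J)%N.
    exact: (@leq_bigmax_seq _ s xpredT (fun q => 2 * snorm q)%N q).
  rewrite [leRHS](@big_cat_nat _ _ _ (snorm q) 1)//=; last lia.
  rewrite [X in _ <= _ + X](@big_cat_nat _ _ _ (2 * snorm q) (snorm q))//=; [|lia|lia].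
  rewrite addrCA -[leLHS]addr0 lerD//.
    rewrite le_eqVlt; apply/orP; left; apply/eqP.
    rewrite big_nat_cond [RHS]big_nat_cond; apply: eq_bigl => j.
    by case: (snorm q <= j)%N; rewrite ?andbT ?andbF.
  by rewrite addr_ge0// sumr_ge0.
rewrite (exchange_big_dep xpredT)//=.
apply: (@le_trans _ _ (\sum_(1 <= j < J.+1) 864 * (r + j%:R) ^- 2)).
  rewrite big_seq [leRHS]big_seq; apply: ler_sum => j.
  rewrite mem_index_iota => /andP[j0 _].
  rewrite -big_filter big_const_seq count_predT iter_addr_0 -[leLHS]mulr_natl.
  have sz : (size [seq q <- s | (snorm q <= j)%N] <= 27 * j ^ 3)%N.
    apply: (leq_trans (@size_box j _ (filter_uniq _ us) (filter_all _ _))).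
    have -> : (27 * j ^ 3 = (3 * j) ^ 3)%N by rewrite expnMn.
    by rewrite leq_exp2r//; lia.
  apply: (@le_trans _ _ ((27 * j ^ 3)%:R * c j)); first by apply: ler_wpM2r => //; rewrite ler_nat.
  rewrite le_eqVlt; apply/orP; left; apply/eqP.
  rewrite /c natrM natrX; have : 0 < j%:R :> R by rewrite ltr0n.
  by move=> j0'; field; rewrite !gt_eqF.
rewrite -mulr_sumr; apply: ler_wpM2l; first exact: ler0n.
by rewrite (le_trans (telescoping_tail J r0))// gerBl invr_ge0 ltW.
Qed.

Lemma radial_ge0 (r : R) n : 0 <= r -> 0 <= radial r n.
Proof. by move=> r0; rewrite mulr_ge0// invr_ge0 exprn_ge0// addr_ge0. Qed.

Lemma radial_esum (r : R) : 0 < r ->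
  (\esum_(q in [set: Z3]) (radial r (snorm q))%:E <= (864 / r)%:E)%E.
Proof.
move=> r0; apply: ge_ereal_sup => _ [X [finX _]] <-.
rewrite fsbig_finite//= sumEFin lee_fin.
exact: radial_sum_seq (fset_uniq _).
Qed.

(** The larger [n] of [snorm q] and [snorm (xi - q)] satisfies
    [snorm xi + m <= 3 * n], where [m] is the smaller one, by the triangle
    inequality; so the product is at most [9 * radial (snorm xi) m], and the sum
    of the two possible right-hand sides avoids a splitting of the lattice. *)
Lemma convolution_le_radial (xi q : Z3) : xi != 0 ->
  (snorm q)%:R ^- 2 * (snorm (xi - q))%:R ^- 2 <=
  9 * radial (snorm xi)%:R (snorm q) + 9 * radial (snorm xi)%:R (snorm (xi - q)) :> R.
Proof.
rewrite -snorm_gt0; have := snorm_split xi q.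
move: (snorm q) (snorm (xi - q)) (snorm xi) => a b r rab r0.
have main (m n : nat) : (0 < m)%N -> (m <= n)%N -> (r <= m + n)%N ->
    m%:R ^- 2 * n%:R ^- 2 <= 9 * radial r%:R m.
  move=> m0 mn rmn.
  have m0' : 0 < m%:R :> R by rewrite ltr0n.
  have r0' : 0 < r%:R :> R by rewrite ltr0n.
  have n0' : 0 < n%:R :> R by rewrite ltr0n; lia.
  rewrite /radial mulrCA ler_wpM2l ?invr_ge0 ?exprn_ge0//.
  have -> : 9 * (r%:R + m%:R) ^- 2 = ((r + m)%:R / 3) ^- 2 :> R.
    by rewrite natrD; field; rewrite gt_eqF// addr_gt0.
  apply: lef_pVX; first by rewrite divr_gt0// ltr0n; lia.
  by rewrite ler_pdivrMr// -natrM ler_nat; lia.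
have [/eqP a0|a0] := posnP a.
  by rewrite (eqP a0) expr0n invr0 mul0r addr_ge0// mulr_ge0// radial_ge0.
have [/eqP b0|b0] := posnP b.
  by rewrite (eqP b0) expr0n invr0 mulr0 addr_ge0// mulr_ge0// radial_ge0.
have [ab|ba] := leqP a b.
  by rewrite -[leLHS]addr0 lerD ?main// mulr_ge0// radial_ge0.
rewrite -[leLHS]add0r lerD//; first by rewrite mulr_ge0// radial_ge0.
by rewrite mulrC main//; lia.
Qed.

(** The two radial majorants have the same sum, by the reflection
    [q |-> xi - q], whence the constant [15552 = 2 * 9 * 864]. *)
Lemma convolution_esum (xi : Z3) : xi != 0 ->
  (\esum_(q in [set: Z3]) ((snorm q)%:R ^- 2 * (snorm (xi - q))%:R ^- 2 : R)%:E
    <= (15552 / (snorm xi)%:R)%:E)%E.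
Proof.
move=> xi0; have r0 : 0 < (snorm xi)%:R :> R by rewrite ltr0n snorm_gt0.
have g0 q : (0 <= (9 * radial (snorm xi)%:R (snorm q))%:E :> \bar R)%E.
  by rewrite lee_fin mulr_ge0// radial_ge0// ltW.
apply: (@le_trans _ _ (\esum_(q in [set: Z3])
   ((9 * radial (snorm xi)%:R (snorm q))%:E + (9 * radial (snorm xi)%:R (snorm (xi - q)))%:E))%E).
  by apply: le_esum => q _; rewrite -EFinD lee_fin convolution_le_radial.
rewrite esumD//.
have -> : (\esum_(q in [set: Z3]) (9 * radial (snorm xi)%:R (snorm (xi - q)))%:E =
          \esum_(q in [set: Z3]) (9 * radial (snorm xi)%:R (snorm q))%:E :> \bar R)%E.
  rewrite [RHS](@reindex_esum _ _ _ setT setT (fun q => xi - q))//.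
  by rewrite setTT_bijective; apply: inv_bij => q; rewrite subKr.
have h := esum_scale_le (ler0n R 9) (radial_esum r0).
apply: (le_trans (leeD h h)); rewrite -EFinD lee_fin !mulrA -mulrDl.
by apply: ler_wpM2r; [rewrite invr_ge0 ltW | clear; lra].
Qed.

(** The factor [snorm xi] is the one brought by the kernel [M]. *)
Lemma convolution_bound : exists2 C0 : R, 0 < C0 & forall xi : Z3,
  (\esum_(q in [set: Z3])
     ((snorm xi)%:R * ((snorm q)%:R ^- 2 * (snorm (xi - q))%:R ^- 2) : R)%:E <= C0%:E)%E.
Proof.
exists 15552 => [|xi]; first by rewrite ltr0n.
have [->|xi0] := eqVneq xi 0.
  rewrite (eqP (_ : snorm 0 == 0%N)) ?snorm_eq0//.
  by rewrite esum1 ?lee_fin ?ler0n// => q _; rewrite mul0r.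
have n0 : 0 < (snorm xi)%:R :> R by rewrite ltr0n snorm_gt0.
apply: le_trans (esum_scale_le (ltW n0) (convolution_esum xi0)) _.
by rewrite mulrC divfK// gt_eqF.
Qed.

End lattice.

(** * The complex modulus *)

Section cmod.
Variable R : realType.
Implicit Types z w : R[i].

Lemma cmod_ge0 z : 0 <= cmod z.
Proof. by rewrite -lecR /cmod RRe_real ?normr_real// normr_ge0. Qed.

Lemma cmodD z w : cmod (z + w) <= cmod z + cmod w.
Proof. exact: le_normcD. Qed.

Lemma cmodN z : cmod (- z) = cmod z.
Proof. exact: normcN. Qed.

Lemma cmodM z w : cmod (z * w) = cmod z * cmod w.
Proof. exact: Normc.normcM. Qed.

Lemma cmod_real (x : R) : cmod x%:C = `|x|.
Proof. by rewrite /cmod normc_def /= expr0n addr0 sqrtr_sqr. Qed.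

Lemma cmod0 : cmod (0 : R[i]) = 0.
Proof. by rewrite (cmod_real 0) normr0. Qed.

Lemma cmod_eq0 z : cmod z <= 0 -> z = 0.
Proof.
move=> z0; apply: Normc.eq0_normc; apply/eqP; rewrite eq_le.
by apply/andP; split=> //; exact: cmod_ge0.
Qed.

Lemma cmod_sum (I : finType) (F : I -> R[i]) : cmod (\sum_i F i) <= \sum_i cmod (F i).
Proof.
apply: (big_ind2 (fun x y => cmod x <= y)) => //; first by rewrite cmod0.
by move=> x1 y1 x2 y2 h1 h2; apply: le_trans (cmodD _ _) (lerD h1 h2).
Qed.

Lemma Re_le_cmod z : `|complex.Re z| <= cmod z.
Proof. by rewrite -lecR /cmod RRe_real ?normr_real// normc_ge_Re. Qed.

Lemma Im_le_cmod z : `|complex.Im z| <= cmod z.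
Proof.
rewrite /cmod normc_def /= -sqrtr_sqr ler_wsqrtr//.
by rewrite lerDr sqr_ge0.
Qed.

Lemma cmod_le_ReIm z : cmod z <= `|complex.Re z| + `|complex.Im z|.
Proof.
rewrite /cmod normc_def /= -[leRHS]ger0_norm ?addr_ge0// -sqrtr_sqr ler_wsqrtr//.
rewrite sqrrD !real_normK ?num_real// addrAC lerDl mulrn_wge0// mulr_ge0.
Qed.

End cmod.

(** * Absolutely convergent real and complex sums *)

Section sums.
Variables (R : realType) (I : choiceType).
Implicit Types f h g : I -> R.

Definition dominated f g (c : R) :=
  (forall i, `|f i| <= g i) /\ (\esum_(i in [set: I]) (g i)%:E <= c%:E)%E.

Let fpos f := \esum_(i in [set: I]) ((EFin \o f)^\+ i)%E.
Let fneg f := \esum_(i in [set: I]) ((EFin \o f)^\- i)%E.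

Lemma dominated_pos f g c : dominated f g c -> (0 <= fpos f <= c%:E)%E.
Proof.
move=> [fg gc]; apply/andP; split; first by apply: esum_ge0 => i _.
apply: le_trans gc; apply: le_esum => i _; rewrite funeposE/= -EFin_max lee_fin.
by rewrite ge_max (le_trans (ler_norm _))// (le_trans (normr_ge0 (f i))).
Qed.

Lemma dominated_neg f g c : dominated f g c -> (0 <= fneg f <= c%:E)%E.
Proof.
move=> [fg gc]; apply/andP; split; first by apply: esum_ge0 => i _.
apply: le_trans gc; apply: le_esum => i _; rewrite funenegE/= -EFin_max lee_fin.
by rewrite ge_max (le_trans (ler_norm _)) ?normrN// (le_trans (normr_ge0 (f i))).
Qed.

Lemma between_fin (x : \bar R) (c : R) : (0 <= x <= c%:E)%E -> exists2 r, x = r%:E & 0 <= r <= c.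
Proof. by case: x => [r||] /andP[]//; rewrite !lee_fin => *; exists r => //; apply/andP. Qed.

Lemma rsum_le f g c : dominated f g c -> `|rsum f| <= c.
Proof.
move=> fg; rewrite /rsum -/(fpos f) -/(fneg f).
have [a -> /andP[a0 ac]] := between_fin (dominated_pos fg).
have [b -> /andP[b0 bc]] := between_fin (dominated_neg fg).
by rewrite /= ler_norml; lra.
Qed.

(** Both [f^+ - f^-] and [h^+ - h^-] are differences of nonnegative summable
    families, so [f - h] is that of [f^+ + h^-] and [f^- + h^+]; [esumB] says that
    any such decomposition computes the same number as the positive and negative
    parts of [f - h]. *)
Lemma rsumB f h g c : dominated f g c -> dominated h g c ->
  rsum (fun i => f i - h i) = rsum f - rsum h.
Proof.
move=> fg hg.
have fhg : dominated (fun i => f i - h i) (fun i => g i + g i) (c + c).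
  split=> [i|].
    by rewrite (le_trans (ler_normB _ _))// lerD// ?fg.1 ?hg.1.
  have g0 i : (0 <= (g i)%:E)%E by rewrite lee_fin (le_trans (normr_ge0 (f i)))// fg.1.
  by under eq_esum do rewrite EFinD; rewrite esumD// EFinD leeD// fg.2.
have [a Ea _] := between_fin (dominated_pos fg).
have [b Eb _] := between_fin (dominated_neg fg).
have [a' Ea' _] := between_fin (dominated_pos hg).
have [b' Eb' _] := between_fin (dominated_neg hg).
have [d Ed _] := between_fin (dominated_pos fhg).
have [e Ee _] := between_fin (dominated_neg fhg).
rewrite /rsum -!/(fpos _) -!/(fneg _).
rewrite Ea Eb Ea' Eb' Ed Ee /=.
pose F i := ((EFin \o f)^\+ i + (EFin \o h)^\- i)%E.
pose H i := ((EFin \o f)^\- i + (EFin \o h)^\+ i)%E.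
have F0 i : (0 <= F i)%E by rewrite adde_ge0.
have H0 i : (0 <= H i)%E by rewrite adde_ge0.
have EF : \esum_(i in [set: I]) F i = (a + b')%:E.
  by rewrite esumD// -/(fpos f) -/(fneg h) Ea Eb'.
have EH : \esum_(i in [set: I]) H i = (b + a')%:E.
  by rewrite esumD// -/(fpos h) -/(fneg f) Eb Ea'.
have sF : summable setT F.
  by rewrite /summable; under eq_esum do rewrite gee0_abs//; rewrite EF ltry.
have sH : summable setT H.
  by rewrite /summable; under eq_esum do rewrite gee0_abs//; rewrite EH ltry.
have := esumB sF sH (fun i _ => F0 i) (fun i _ => H0 i).
have -> : (F \- H)%E = EFin \o (fun i => f i - h i).
  apply/funext => i; rewrite /F /H /= !funeposE !funenegE /= -!EFin_max.
  rewrite -!EFinD; congr EFin; rewrite /Num.max.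
  by do ![case: ifPn]; rewrite -?leNgt; lra.
rewrite -/(fpos _) -/(fneg _) Ed Ee EF EH => -[]; lra.
Qed.

End sums.

Section csum.
Variables (R : realType) (I : choiceType).
Implicit Types (f h : I -> R[i]) (g : I -> R).

Definition cdominated f g (c : R) :=
  (forall i, cmod (f i) <= g i) /\ (\esum_(i in [set: I]) (g i)%:E <= c%:E)%E.

Lemma cdominated_Re f g c : cdominated f g c -> dominated (fun i => complex.Re (f i)) g c.
Proof. by move=> [fg gc]; split=> // i; exact: le_trans (Re_le_cmod _) (fg i). Qed.

Lemma cdominated_Im f g c : cdominated f g c -> dominated (fun i => complex.Im (f i)) g c.
Proof. by move=> [fg gc]; split=> // i; exact: le_trans (Im_le_cmod _) (fg i). Qed.

Lemma csum_le f g c : cdominated f g c -> cmod (csum f) <= 2 * c.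
Proof.
move=> fg; apply: le_trans (cmod_le_ReIm _) _ => /=.
have := rsum_le (cdominated_Re fg); have := rsum_le (cdominated_Im fg); lra.
Qed.

Lemma csumB f h g c : cdominated f g c -> cdominated h g c ->
  csum (fun i => f i - h i) = csum f - csum h.
Proof.
move=> fg hg; rewrite /csum.
have -> : (fun i => complex.Re (f i - h i)) = (fun i => complex.Re (f i) - complex.Re (h i)).
  by apply/funext => i; rewrite raddfB.
have -> : (fun i => complex.Im (f i - h i)) = (fun i => complex.Im (f i) - complex.Im (h i)).
  by apply/funext => i; rewrite raddfB.
rewrite (rsumB (cdominated_Re fg) (cdominated_Re hg)).
by rewrite (rsumB (cdominated_Im fg) (cdominated_Im hg)).
Qed.

End csum.

Section measurability.
Context d (T : measurableType d) (R : realType) (I : countType) (D : set T).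

(** Along an encoding of [I] into the natural numbers the sum becomes a countable
    series of nonnegative measurable functions. *)
Lemma measurable_esum (G : I -> T -> \bar R) : (forall i x, 0 <= G i x)%E ->
  (forall i, measurable_fun D (G i)) ->
  measurable_fun D (fun x => \esum_(i in [set: I]) G i x).
Proof.
move=> G0 mG.
pose h (n : nat) (x : T) : \bar R := oapp (G ^~ x) 0%E (pickle_inv n).
have h0 n x : (0 <= h n x)%E by rewrite /h; case: pickle_inv => /=.
have mh n : xpredT n -> measurable_fun D (h n).
  by move=> _; rewrite /h; case: pickle_inv => [i|]; [exact: mG|exact: measurable_cst].
apply: eq_measurable_fun (ge0_emeasurable_sum (fun n x _ _ => h0 n x) mh) => x _.
rewrite nneseries_esum//= [LHS](_ : _ = \esum_(n in range (@pickle I)) h n x).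
  rewrite (@reindex_esum _ _ _ setT _ (@pickle I)).
    by apply: eq_esum => i _; rewrite /h pickleK_inv.
  by apply: inj_bij => i j _ _; exact: (pcan_inj pickleK).
rewrite [LHS]esum_mkcond [RHS]esum_mkcond; apply: eq_esum => n _.
rewrite ifT; last by rewrite inE.
case: ifPn => // /negP; rewrite inE => nr.
rewrite /h; case E : (pickle_inv n) => [i|//]; exfalso; apply: nr; exists i => //.
by have := @pickle_invK I n; rewrite E.
Qed.

Lemma measurable_rsum (F : I -> T -> R) : (forall i, measurable_fun D (F i)) ->
  measurable_fun D (fun x => rsum (F ^~ x)).
Proof.
move=> mF.
apply: measurable_funB; apply: measurableT_comp => //; apply: measurable_esum => // i.
- have mFi : measurable_fun D (EFin \o F i) by exact/measurable_EFinP.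
  by apply: eq_measurable_fun (measurable_funepos mFi) => x _; rewrite !funeposE.
- have mFi : measurable_fun D (EFin \o F i) by exact/measurable_EFinP.
  by apply: eq_measurable_fun (measurable_funeneg mFi) => x _; rewrite !funenegE.
Qed.

End measurability.

(** * Convolution in time with the heat semigroup *)

Section duhamel.
Variable R : realType.
Local Notation mu := (@lebesgue_measure R).
Implicit Types (a b t s B : R).

Definition tame (g : R -> R) : Prop :=
  (forall T : R, measurable_fun `[0, T] g) /\
  exists B, forall s, 0 <= s -> `|g s| <= B.

Definition heat_weight a t s := expR (- (a * (t - s))).

Lemma measurable_heat_weight (D : set R) a t : measurable_fun D (heat_weight a t).
Proof.
apply: measurable_funTS; apply: measurableT_comp => //.
apply: measurableT_comp => //; apply: measurable_funM => //.
exact: measurable_funB.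
Qed.

Lemma tame_integrable (g : R -> R) t : tame g -> mu.-integrable `[0, t] (EFin \o g).
Proof.
move=> [mg [B gB]]; apply: measurable_bounded_integrable => //; last 1 first.
- exists B; split; first exact: num_real.
  move=> x Bx s /=; rewrite in_itv /= => /andP[s0 _].
  by rewrite (le_trans (gB s s0))// ltW.
- by rewrite /= lebesgue_measure_itv /=; case: ifPn => // _; rewrite -EFinB ltry.
- exact: mg.
Qed.

(** For [a > 0], [heat_weight a t s] is unbounded as [s] tends to infinity, hence
    the truncation at [t], which does not affect integrals over [[0, t]]. *)
Lemma tame_heat_weight a t : 0 <= a -> 0 <= t ->
  tame (fun s => if s <= t then heat_weight a t s else 0).
Proof.
move=> a0 t0; split=> [T|].
  apply: measurable_fun_if => //; first exact: measurable_fun_ler.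
  exact: measurable_heat_weight.
exists 1 => s s0; case: ifPn => [st|_]; last by rewrite normr0.
by rewrite ger0_norm ?expR_ge0// -expR0 ler_expR oppr_le0 mulr_ge0// subr_ge0.
Qed.

Lemma tameM (g h : R -> R) : tame g -> tame h -> tame (fun s => g s * h s).
Proof.
move=> [mg [B gB]] [mh [C hC]]; split=> [T|]; first exact: measurable_funM.
by exists (B * C) => s s0; rewrite normrM ler_pM ?gB ?hC.
Qed.

Lemma heat_weight_integrable a t (g : R -> R) : 0 <= a -> 0 <= t -> tame g ->
  mu.-integrable `[0, t] (EFin \o (fun s => heat_weight a t s * g s)).
Proof.
move=> a0 t0 tg.
have := tame_integrable t (tameM (tame_heat_weight a0 t0) tg).
apply: eq_integrable => // s; rewrite inE /= in_itv /= => /andP[_ st].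
by rewrite st.
Qed.

Lemma Rintegral_heat_weight a t : 0 < a -> 0 <= t ->
  \int[mu]_(s in `[0, t]) heat_weight a t s <= a^-1.
Proof.
move=> a0; rewrite le_eqVlt => /predU1P[<-|t0].
  by rewrite set_itv1 Rintegral_set1 invr_ge0 ltW.
have cw : continuous (heat_weight a t).
  move=> s; apply: continuous_comp; last exact: continuous_expR.
  by apply: cvgN; apply: cvgM; [exact: cvg_cst | apply: cvgB; [exact: cvg_cst|exact: cvg_id]].
pose F s := a^-1 * heat_weight a t s.
have dF s : is_derive s (1 : R) F (heat_weight a t s).
  rewrite /F /heat_weight; apply: is_derive_eq.
  rewrite /GRing.scale /=; set e := expR _.
  by field; rewrite gt_eqF.
have cF : continuous F.
  by move=> s; apply: cvgM; [exact: cvg_cst | exact: cw].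
rewrite /Rintegral (@continuous_FTC2 _ (heat_weight a t) F 0 t)//.
- rewrite /= /F /heat_weight subrr mulr0 oppr0 expR0 mulr1.
  by rewrite gerBl mulr_ge0 ?invr_ge0 ?expR_ge0 ?ltW.
- exact: continuous_subspaceT.
- split=> [s _||]; last 2 first.
  + exact/cvg_at_right_filter/cF.
  + exact/cvg_at_left_filter/cF.
  by case: (dF s).
- by move=> s _; rewrite derive1E; apply: derive_val.
Qed.

(** The mechanism of the smoothing estimate: as [2 * b <= a], one half of the heat
    decay from [s] to [t] suffices to transport the factor [expR (- (b * s))] to
    time [t], and the other half remains integrable in [s]. *)
Lemma heat_weight_transfer a b t s : 2 * b <= a -> s <= t ->
  heat_weight a t s * expR (- (b * s)) <= expR (- (b * t)) * heat_weight (a / 2) t s.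
Proof. by move=> ba st; rewrite -!expRD ler_expR; nra. Qed.

Lemma Rduhamel_le a b B t (g : R -> R) : 0 < a -> 2 * b <= a -> 0 <= B -> 0 <= t ->
  tame g -> (forall s, 0 <= s <= t -> `|g s| <= B * expR (- (b * s))) ->
  `|\int[mu]_(s in `[0, t]) (heat_weight a t s * g s)| <= 2 / a * B * expR (- (b * t)).
Proof.
move=> a0 ba B0 t0 tg gB.
have a20 : 0 < a / 2 by rewrite divr_gt0.
have ig := heat_weight_integrable (ltW a0) t0 tg.
have i1 : mu.-integrable `[0, t] (EFin \o heat_weight (a / 2) t).
  have := heat_weight_integrable (ltW a20) t0 (g := fun=> 1) _.
  rewrite (_ : (fun s => heat_weight (a / 2) t s * 1) = heat_weight (a / 2) t).
    apply; split=> [T|]; first exact: measurable_cst.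
    by exists 1 => s _; rewrite normr1.
  by apply/funext => s; rewrite mulr1.
apply: (le_trans (le_normr_Rintegral _ ig)) => //.
apply: (@le_trans _ _ (\int[mu]_(s in `[0, t]) (B * expR (- (b * t)) * heat_weight (a / 2) t s))).
  apply: le_Rintegral => //.
  - exact: (integrable_norm ig).
  - exact: integrableZl i1.
  move=> s /=; rewrite in_itv /= => /andP[s0 st].
  rewrite normrM [X in X * _]ger0_norm ?expR_ge0// -mulrA.
  apply: (@le_trans _ _ (B * (heat_weight a t s * expR (- (b * s))))).
    by rewrite mulrCA ler_wpM2l ?expR_ge0// gB// s0.
  by rewrite ler_wpM2l// heat_weight_transfer.
rewrite RintegralZl//.
have := Rintegral_heat_weight a20 t0.
rewrite invf_div => h; rewrite -[leRHS]mulrA [leRHS]mulrC.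
by apply: ler_wpM2l => //; rewrite mulr_ge0 ?expR_ge0.
Qed.

(** As [expR (- (a * (t - s)))] is the product of [expR (- (a * t))] and
    [expR (a * s)], the dependence on [t] reduces to that of a primitive, which is
    continuous. *)
Lemma Rduhamel_measurable a T (g : R -> R) : 0 <= a -> tame g ->
  measurable_fun (`[0, T] : set R) (fun t => \int[mu]_(s in `[0, t]) (heat_weight a t s * g s)).
Proof.
move=> a0 tg.
pose G s := expR (a * s) * g s.
have [T0|T0] := leP 0 T; last by rewrite set_itv_ge// -?ltNge ?bnd_simp//; exact: measurable_fun_set0.
have iG t : 0 <= t -> mu.-integrable `[0, t] (EFin \o G).
  move=> t0.
  have iZ : mu.-integrable `[0, t]
      (fun s => (expR (a * t))%:E * (heat_weight a t s * g s)%:E)%E.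
    by apply: integrableZl => //; exact: heat_weight_integrable.
  move: iZ; apply: eq_integrable => // s _ /=; rewrite -EFinM; congr EFin.
  by rewrite /G /heat_weight mulrA -expRD; congr (expR _ * _); ring.
apply: (@eq_measurable_fun _ _ _ _ _ (fun t => expR (- (a * t)) * parameterized_integral mu 0 t G)).
  move=> t; rewrite inE /= in_itv /= => /andP[t0 _].
  rewrite /parameterized_integral -RintegralZl//; last exact: iG.
  apply: eq_Rintegral => s _.
  by rewrite /G /heat_weight mulrA -expRD; congr (expR _ * _); ring.
apply: measurable_funM.
  apply: measurable_funTS; apply: measurableT_comp => //.
  by apply: measurableT_comp => //; exact: measurable_funM.
apply: subspace_continuous_measurable_fun => //.
exact: parameterized_integral_continuous T0 (iG _ T0).
Qed.

End duhamel.

(** * Measurable complex functions *)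

Section complex_measurability.
Variables (R : realType) (D : set R).
Implicit Types f g : R -> R[i].

Lemma cmeasurable_cst (z : R[i]) : cmeasurable_fun D (fun=> z).
Proof. by split; exact: measurable_cst. Qed.

Lemma cmeasurableD f g : cmeasurable_fun D f -> cmeasurable_fun D g ->
  cmeasurable_fun D (fun x => f x + g x).
Proof.
move=> [fr fi] [gr gi]; split.
  by apply: eq_measurable_fun (measurable_funD fr gr) => x _; rewrite raddfD.
by apply: eq_measurable_fun (measurable_funD fi gi) => x _; rewrite raddfD.
Qed.

Lemma cmeasurableM f g : cmeasurable_fun D f -> cmeasurable_fun D g ->
  cmeasurable_fun D (fun x => f x * g x).
Proof.
move=> [fr fi] [gr gi]; split.
  apply: eq_measurable_fun (measurable_funB (measurable_funM fr gr) (measurable_funM fi gi)).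
  by move=> x _ /=; case: (f x) (g x) => [a b] [c d].
apply: eq_measurable_fun (measurable_funD (measurable_funM fr gi) (measurable_funM fi gr)).
by move=> x _ /=; case: (f x) (g x) => [a b] [c d] /=; rewrite [b * c]mulrC.
Qed.

Lemma cmeasurableB f g : cmeasurable_fun D f -> cmeasurable_fun D g ->
  cmeasurable_fun D (fun x => f x - g x).
Proof.
move=> mf mg; have := cmeasurableD mf (cmeasurableM (cmeasurable_cst (-1)) mg).
by rewrite (_ : (fun x => _) = (fun x => f x - g x))//; apply/funext => x; rewrite mulN1r.
Qed.

Lemma cmeasurable_sum (I : finType) (F : I -> R -> R[i]) :
  (forall i, cmeasurable_fun D (F i)) -> cmeasurable_fun D (fun x => \sum_i F i x).
Proof.
move=> mF; elim: (index_enum I) => [|i s IH].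
  by under eq_fun do rewrite big_nil; exact: cmeasurable_cst.
by under eq_fun do rewrite big_cons; exact: cmeasurableD.
Qed.

Lemma cmeasurable_csum (I : countType) (F : I -> R -> R[i]) :
  (forall i, cmeasurable_fun D (F i)) -> cmeasurable_fun D (fun x => csum (F ^~ x)).
Proof.
move=> mF; split.
  exact: (measurable_rsum (F := fun i x => complex.Re (F i x)) (fun i => (mF i).1)).
exact: (measurable_rsum (F := fun i x => complex.Im (F i x)) (fun i => (mF i).2)).
Qed.

End complex_measurability.

(** * The Duhamel integral of a complex function *)

Section complex_duhamel.
Variable R : realType.
Local Notation mu := (@lebesgue_measure R).
Implicit Types (g h : R -> R[i]) (a b B t : R).

Definition ctame g :=
  tame (fun s => complex.Re (g s)) /\ tame (fun s => complex.Im (g s)).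

Lemma ctame_bounded g B : (forall T : R, cmeasurable_fun `[0, T] g) ->
  (forall s, 0 <= s -> cmod (g s) <= B) -> ctame g.
Proof.
move=> mg gB; split.
  split=> [T|]; first exact: (mg T).1.
  by exists B => s s0; exact: le_trans (Re_le_cmod _) (gB s s0).
split=> [T|]; first exact: (mg T).2.
by exists B => s s0; exact: le_trans (Im_le_cmod _) (gB s s0).
Qed.

Definition duhamel a g t : R[i] :=
  cintegral `[0, t] (fun s => (heat_weight a t s)%:C * g s).

Lemma duhamelE a g t : duhamel a g t =
  (\int[mu]_(s in `[0, t]) (heat_weight a t s * complex.Re (g s))) +i*
  (\int[mu]_(s in `[0, t]) (heat_weight a t s * complex.Im (g s))).
Proof.
rewrite /duhamel /cintegral; congr (_ +i* _); apply: eq_Rintegral => s _.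
  by case: (g s) => x y /=; rewrite mul0r subr0.
by case: (g s) => x y /=; rewrite mul0r addr0.
Qed.

Lemma duhamel_le a b B t g : 0 < a -> 2 * b <= a -> 0 <= B -> 0 <= t -> ctame g ->
  (forall s, 0 <= s <= t -> cmod (g s) <= B * expR (- (b * s))) ->
  cmod (duhamel a g t) <= 4 / a * B * expR (- (b * t)).
Proof.
move=> a0 ba B0 t0 [tr ti] gB; rewrite duhamelE.
apply: le_trans (cmod_le_ReIm _) _ => /=.
have hr := Rduhamel_le a0 ba B0 t0 tr
  (fun s hs => le_trans (Re_le_cmod _) (gB s hs)).
have hi := Rduhamel_le a0 ba B0 t0 ti
  (fun s hs => le_trans (Im_le_cmod _) (gB s hs)).
apply: (le_trans (lerD hr hi)); rewrite -!mulrDl.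
by rewrite (_ : 2 + 2 = 4 :> R)//; lra.
Qed.

Lemma duhamelB a t g h : 0 <= a -> 0 <= t -> ctame g -> ctame h ->
  duhamel a (fun s => g s - h s) t = duhamel a g t - duhamel a h t.
Proof.
move=> a0 t0 [gr gi] [hr hi]; rewrite !duhamelE.
apply/eqP; rewrite eq_complex /=; apply/andP; split; apply/eqP.
  rewrite -RintegralB//; try exact: heat_weight_integrable.
  by apply: eq_Rintegral => s _; rewrite raddfB /= mulrBr.
rewrite -RintegralB//; try exact: heat_weight_integrable.
by apply: eq_Rintegral => s _; rewrite raddfB /= mulrBr.
Qed.

Lemma duhamel0 a t : duhamel a (fun=> 0) t = 0.
Proof.
rewrite duhamelE /=; under eq_Rintegral do rewrite mulr0.
by rewrite /Rintegral integral0.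
Qed.

Lemma duhamel_measurable a g (T : R) : 0 <= a -> ctame g ->
  cmeasurable_fun `[0, T] (duhamel a g).
Proof.
move=> a0 [gr gi]; split.
  rewrite (_ : (fun t => complex.Re _) = (fun t =>
      \int[mu]_(s in `[0, t]) (heat_weight a t s * complex.Re (g s)))).
    exact: Rduhamel_measurable.
  by apply/funext => t; rewrite duhamelE.
rewrite (_ : (fun t => complex.Im _) = (fun t =>
    \int[mu]_(s in `[0, t]) (heat_weight a t s * complex.Im (g s)))).
  exact: Rduhamel_measurable.
by apply/funext => t; rewrite duhamelE.
Qed.

End complex_duhamel.

(** * The exponential weight *)

Section weight.
Variable R : realType.
Implicit Types (s t : R) (n m : nat).

(** The decay in which the solution is constructed.  At [n = 0] the weight is [0]
    because [0^-1 = 0], so a field bounded by it vanishes at frequency [0]. *)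
Definition gevrey_weight n t : R := n%:R ^- 2 * expR (- (n%:R / 2 * t)).

Lemma gevrey_weight_ge0 n t : 0 <= gevrey_weight n t.
Proof. by rewrite mulr_ge0 ?expR_ge0// invr_ge0 exprn_ge0. Qed.

Lemma gevrey_weight0 t : gevrey_weight 0 t = 0.
Proof. by rewrite /gevrey_weight expr0n invr0 mul0r. Qed.

(** The exponential factor is submultiplicative by the triangle inequality, so a
    product of two weights keeps the exponential factor of the sum of the
    frequencies: this is why the weight survives the convolution. *)
Lemma gevrey_weightM (xi q : Z3) s : 0 <= s ->
  gevrey_weight (snorm q) s * gevrey_weight (snorm (xi - q)) s <=
  expR (- ((snorm xi)%:R / 2 * s)) *
    ((snorm q)%:R ^- 2 * (snorm (xi - q))%:R ^- 2).
Proof.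
move=> s0; rewrite /gevrey_weight mulrACA [leRHS]mulrC; apply: ler_wpM2l.
  by rewrite mulr_ge0// invr_ge0 exprn_ge0.
rewrite -expRD ler_expR -opprD lerN2 -mulrDl ler_wpM2r// -mulrDl ler_wpM2r//.
by rewrite -natrD ler_nat snorm_split.
Qed.

Lemma decay_le1 n s : 0 <= s -> expR (- (n%:R / 2 * s)) <= 1.
Proof. by move=> s0; rewrite -[leRHS]expR0 ler_expR oppr_le0 !mulr_ge0. Qed.

(** On the lattice [n <= n ^ 2], so the heat semigroup decays faster than the
    exponential of the weight. *)
Lemma heat_decay (a : R) n t : (n%:R : R) ^+ 2 <= a -> 0 <= t ->
  expR (- (a * t)) <= expR (- (n%:R / 2 * t)).
Proof.
move=> na t0; rewrite ler_expR lerN2 ler_wpM2r//.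
case: n na => [|n] na; first by rewrite mul0r; move: na; rewrite expr0n.
have : 1 <= n.+1%:R :> R by rewrite ler1n.
by move: na; set x := n.+1%:R; nra.
Qed.

Lemma snorm_sqr_le_enorm (xi : Z3) : (snorm xi)%:R ^+ 2 <= enorm R xi ^+ 2.
Proof. by rewrite lerXn2r ?nnegrE ?enorm_ge_snorm// sqrtr_ge0. Qed.

End weight.

(** * Estimates for the integral equation *)

Section estimates.
Variables (R : realType) (M : 'I_3 -> 'I_3 -> 'I_3 -> Z3 -> R[i]).
Hypothesis hM : forall (i j k : 'I_3) (xi : Z3), cmod (M i j k xi) <= enorm R xi.
Variable C0 : R.
Hypothesis C0_gt0 : 0 < C0.
Hypothesis convC0 : forall xi : Z3,
  (\esum_(q in [set: Z3])
     ((snorm xi)%:R * ((snorm q)%:R ^- 2 * (snorm (xi - q))%:R ^- 2) : R)%:E <= C0%:E)%E.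

Local Notation C := R[i].
Local Notation field := (Z3 -> R -> 'rV[C]_3).
Implicit Types (u v w : field) (xi q : Z3) (k : 'I_3) (s t A B : R).
Local Notation wt := (@gevrey_weight R).

Definition interaction (x y : 'rV[C]_3) k xi : C :=
  \sum_(i < 3) \sum_(j < 3) M i j k xi * x 0 i * y 0 j.

Lemma nonlinearityE v k xi s :
  nonlinearity M v k xi s = csum (fun q => interaction (v q s) (v (xi - q) s) k xi).
Proof. by []. Qed.

(** The constant is [18 = 9 * 2]: there are nine pairs of indices, and
    [enorm xi <= 2 * snorm xi]. *)
Lemma interaction_le (x y : 'rV[C]_3) k xi a b : 0 <= a -> 0 <= b ->
  (forall i, cmod (x 0 i) <= a) -> (forall i, cmod (y 0 i) <= b) ->
  cmod (interaction x y k xi) <= 18 * (snorm xi)%:R * (a * b).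
Proof.
move=> a0 b0 xa yb; apply: le_trans (cmod_sum _) _.
apply: (@le_trans _ _ (\sum_(i < 3) \sum_(j < 3) (2 * (snorm xi)%:R * (a * b)))).
  apply: ler_sum => i _; apply: le_trans (cmod_sum _) _.
  apply: ler_sum => j _; rewrite !cmodM -mulrA.
  apply: ler_pM; rewrite ?mulr_ge0 ?cmod_ge0//.
    exact: le_trans (hM _ _ _ _) (enorm_le_snorm _ _).
  by apply: ler_pM; rewrite ?cmod_ge0.
by rewrite !sumr_const !card_ord; lra.
Qed.

Lemma interaction_subE (x y x' y' : 'rV[C]_3) k xi :
  interaction x y k xi - interaction x' y' k xi =
  interaction (x - x') y k xi + interaction x' (y - y') k xi.
Proof.
rewrite /interaction -sumrB -big_split /=; apply: eq_bigr => i _.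
rewrite -sumrB -big_split /=; apply: eq_bigr => j _.
rewrite !mxE; ring.
Qed.

Definition bounded_by A u :=
  forall xi t k, 0 <= t -> cmod (u xi t 0 k) <= A * wt (snorm xi) t.

Definition time_measurable u :=
  forall xi k (T : R), cmeasurable_fun `[0, T] (fun t => u xi t 0 k).

Definition interaction_majorant xi A s q : R :=
  18 * A * expR (- ((snorm xi)%:R / 2 * s)) *
  ((snorm xi)%:R * ((snorm q)%:R ^- 2 * (snorm (xi - q))%:R ^- 2)).

Lemma interaction_majorant_le A B u w xi k s q : 0 <= A -> 0 <= B -> 0 <= s ->
  bounded_by A u -> bounded_by B w ->
  cmod (interaction (u q s) (w (xi - q) s) k xi) <= interaction_majorant xi (A * B) s q.
Proof.
move=> A0 B0 s0 uA wB.
apply: le_trans (interaction_le (a := A * wt (snorm q) s)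
  (b := B * wt (snorm (xi - q)) s) _ _ _ _ _ _) _.
- by rewrite mulr_ge0// gevrey_weight_ge0.
- by rewrite mulr_ge0// gevrey_weight_ge0.
- by move=> i; exact: uA.
- by move=> i; exact: wB.
have := gevrey_weightM xi q s0.
rewrite /interaction_majorant.
set a := wt _ _; set b := wt _ _; set E := expR _; set P := (_ ^- 2 * _ ^- 2) => abE.
rewrite (_ : A * a * (B * b) = A * B * (a * b)); last by ring.
rewrite (_ : 18 * (A * B) * E * ((snorm xi)%:R * P) =
             18 * (snorm xi)%:R * ((A * B) * (E * P))); last by ring.
by rewrite !ler_wpM2l ?mulr_ge0.
Qed.

Lemma interaction_majorant_esum A xi s : 0 <= A ->
  (\esum_(q in [set: Z3]) (interaction_majorant xi A s q)%:E <=
    (18 * A * expR (- ((snorm xi)%:R / 2 * s)) * C0)%:E)%E.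
Proof.
move=> A0; apply: esum_scale_le; last exact: convC0.
by rewrite !mulr_ge0 ?expR_ge0.
Qed.

Lemma interaction_cdominated A u xi k s : 0 <= A -> 0 <= s -> bounded_by A u ->
  cdominated (fun q => interaction (u q s) (u (xi - q) s) k xi)
    (interaction_majorant xi (A * A) s)
    (18 * (A * A) * expR (- ((snorm xi)%:R / 2 * s)) * C0).
Proof.
move=> A0 s0 uA; split=> [q|]; first exact: interaction_majorant_le.
by apply: interaction_majorant_esum; rewrite mulr_ge0.
Qed.

Lemma nonlinearity_le A u xi k s : 0 <= A -> 0 <= s -> bounded_by A u ->
  cmod (nonlinearity M u k xi s) <=
  36 * C0 * A ^+ 2 * expR (- ((snorm xi)%:R / 2 * s)).
Proof.
move=> A0 s0 uA; rewrite nonlinearityE.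
apply: le_trans (csum_le (interaction_cdominated xi k A0 s0 uA)) _.
by rewrite le_eqVlt; apply/orP; left; apply/eqP; ring.
Qed.

Lemma nonlinearityB_le A D u w xi k s : 0 <= A -> 0 <= D -> 0 <= s ->
  bounded_by A u -> bounded_by A w -> bounded_by D (fun xi t => u xi t - w xi t) ->
  cmod (nonlinearity M u k xi s - nonlinearity M w k xi s) <=
  72 * C0 * A * D * expR (- ((snorm xi)%:R / 2 * s)).
Proof.
move=> A0 D0 s0 uA wA uwD; rewrite !nonlinearityE.
rewrite -(csumB (interaction_cdominated xi k A0 s0 uA)
                (interaction_cdominated xi k A0 s0 wA)).
have AD0 : 0 <= 2 * (A * D) by rewrite !mulr_ge0.
apply: (@le_trans _ _ (2 * (18 * (2 * (A * D)) * expR (- ((snorm xi)%:R / 2 * s)) * C0))).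
  apply: (@csum_le _ _ _ (interaction_majorant xi (2 * (A * D)) s)); split=> [q|]; last first.
    exact: interaction_majorant_esum.
  rewrite interaction_subE; apply: le_trans (cmodD _ _) _.
  have h1 := interaction_majorant_le xi k q D0 A0 s0 uwD uA.
  have h2 := interaction_majorant_le xi k q A0 D0 s0 wA uwD.
  apply: le_trans (lerD h1 h2) _; rewrite le_eqVlt; apply/orP; left; apply/eqP.
  by rewrite /interaction_majorant; ring.
by rewrite le_eqVlt; apply/orP; left; apply/eqP; ring.
Qed.

(** The kernel [M] vanishes at frequency [0]; this case is kept apart because there
    the heat semigroup has no decay to offer. *)
Lemma nonlinearity_at0 u k : nonlinearity M u k 0 = fun=> 0.
Proof.
apply/funext => s; rewrite nonlinearityE; apply: cmod_eq0.
rewrite -[leRHS](mulr0 2); apply: (@csum_le _ _ _ (fun=> 0)); split; last by rewrite esum1.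
move=> q; rewrite (_ : interaction _ _ _ _ = 0) ?cmod0//.
rewrite /interaction big1// => i _; rewrite big1// => j _.
rewrite (@cmod_eq0 _ (M i j k 0)) ?mul0r//.
apply: le_trans (hM _ _ _ _) _; apply: le_trans (enorm_le_snorm _ _) _.
by rewrite (eqP (_ : snorm 0 == 0%N)) ?snorm_eq0 ?mulr0.
Qed.

Lemma nonlinearity_measurable u xi k (T : R) : time_measurable u ->
  cmeasurable_fun `[0, T] (nonlinearity M u k xi).
Proof.
move=> mu.
apply: (@cmeasurable_csum _ _ _ (fun q s => interaction (u q s) (u (xi - q) s) k xi)) => q.
apply: cmeasurable_sum => i; apply: cmeasurable_sum => j.
apply: cmeasurableM; last exact: mu.
by apply: cmeasurableM; [exact: cmeasurable_cst | exact: mu].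
Qed.

Lemma nonlinearity_ctame A u xi k : 0 <= A -> bounded_by A u -> time_measurable u ->
  ctame (nonlinearity M u k xi).
Proof.
move=> A0 uA mu; apply: (@ctame_bounded _ _ (36 * C0 * A ^+ 2)).
  by move=> T; exact: nonlinearity_measurable.
move=> s s0; apply: le_trans (nonlinearity_le xi k A0 s0 uA) _.
rewrite -[leRHS]mulr1; apply: ler_wpM2l; last exact: decay_le1.
by rewrite mulr_ge0 ?exprn_ge0// mulr_ge0// ltW.
Qed.

(** Integration in time gains the factor [snorm xi ^- 2] that the convolution sum
    lost. *)
Lemma duhamel_gevrey B xi t g : xi != 0 -> 0 <= B -> 0 <= t -> ctame g ->
  (forall s, 0 <= s -> cmod (g s) <= B * expR (- ((snorm xi)%:R / 2 * s))) ->
  cmod (duhamel (enorm R xi ^+ 2) g t) <= 4 * B * wt (snorm xi) t.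
Proof.
move=> xi0 B0 t0 tg gB.
have n1 : 1 <= (snorm xi)%:R :> R by rewrite ler1n snorm_gt0.
have na := snorm_sqr_le_enorm R xi.
have n0 : 0 < (snorm xi)%:R ^+ 2 :> R by rewrite exprn_gt0// (lt_le_trans ltr01).
have a0 := lt_le_trans n0 na.
apply: le_trans (duhamel_le (b := (snorm xi)%:R / 2) a0 _ B0 t0 tg _) _.
- by apply: le_trans na; nra.
- by move=> s /andP[s0 _]; exact: gB.
rewrite /gevrey_weight -!mulrA ler_wpM2l// [leLHS]mulrCA ler_wpM2l//.
by rewrite ler_wpM2r ?expR_ge0// lef_pV2.
Qed.

Variable psi : Z3 -> 'rV[C]_3.

(** The right-hand side of the integral equation. *)
Definition duhamel_map u : field := fun xi t =>
  \row_k (psi xi 0 k * (expR (- (enorm R xi ^+ 2 * t)))%:C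
          + duhamel (enorm R xi ^+ 2) (nonlinearity M u k xi) t).

Lemma duhamel_map_measurable A u : 0 <= A -> bounded_by A u -> time_measurable u ->
  time_measurable (duhamel_map u).
Proof.
move=> A0 uA mu xi k T; 
have -> : (fun t => duhamel_map u xi t 0 k) =
    (fun t => psi xi 0 k * (expR (- (enorm R xi ^+ 2 * t)))%:C
              + duhamel (enorm R xi ^+ 2) (nonlinearity M u k xi) t).
  by apply/funext => t; rewrite mxE.
apply: cmeasurableD; last first.
  by apply: duhamel_measurable (nonlinearity_ctame xi k A0 uA mu); rewrite sqr_ge0.
apply: cmeasurableM; first exact: cmeasurable_cst.
split; last exact: measurable_cst.
apply: measurable_funTS; apply: measurableT_comp => //.
by apply: measurableT_comp => //; exact: measurable_funM.
Qed.

Lemma duhamel_map_bounded eps A u : 0 <= A -> bounded_by A u -> time_measurable u ->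
  (forall xi k, cmod (psi xi 0 k) <= eps * (snorm xi)%:R ^- 2) ->
  bounded_by (eps + 144 * C0 * A ^+ 2) (duhamel_map u).
Proof.
move=> A0 uA mu psie xi t k t0; rewrite mxE.
apply: le_trans (cmodD _ _) _; rewrite mulrDl; apply: lerD.
  rewrite cmodM cmod_real ger0_norm ?expR_ge0// mulrA.
  by apply: ler_pM; rewrite ?cmod_ge0 ?expR_ge0 ?psie// heat_decay// snorm_sqr_le_enorm.
have C0_ge0 := ltW C0_gt0.
have K0 : 0 <= 36 * C0 * A ^+ 2 by rewrite !mulr_ge0// exprn_ge0.
have [->|xi0] := eqVneq xi 0.
  by rewrite nonlinearity_at0 duhamel0 cmod0 !mulr_ge0 ?gevrey_weight_ge0 ?exprn_ge0.
apply: le_trans (duhamel_gevrey xi0 K0 t0 (nonlinearity_ctame xi k A0 uA mu) _) _.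
  by move=> s s0; exact: nonlinearity_le.
by rewrite le_eqVlt; apply/orP; left; apply/eqP; ring.
Qed.

Lemma duhamel_mapB_bounded A D u w : 0 <= A -> 0 <= D ->
  bounded_by A u -> bounded_by A w -> time_measurable u -> time_measurable w ->
  bounded_by D (fun xi t => u xi t - w xi t) ->
  bounded_by (288 * C0 * A * D) (fun xi t => duhamel_map u xi t - duhamel_map w xi t).
Proof.
move=> A0 D0 uA wA mu mw uwD xi t k t0; rewrite !mxE opprD addrACA subrr add0r.
have tu := nonlinearity_ctame xi k A0 uA mu.
have tw := nonlinearity_ctame xi k A0 wA mw.
have C0_ge0 := ltW C0_gt0.
have K0 : 0 <= 72 * C0 * A * D by rewrite !mulr_ge0.
have [->|xi0] := eqVneq xi 0.
  by rewrite !nonlinearity_at0 subrr cmod0 !mulr_ge0 ?gevrey_weight_ge0.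
rewrite -duhamelB ?sqr_ge0//.
apply: le_trans (duhamel_gevrey xi0 K0 t0 _ _) _.
- apply: (@ctame_bounded _ _ (72 * C0 * A * D)) => [T|s s0].
    by apply: cmeasurableB; exact: nonlinearity_measurable.
  apply: le_trans (nonlinearityB_le xi k A0 D0 s0 uA wA uwD) _.
  rewrite -[leRHS]mulr1 ler_wpM2l//.
  exact: decay_le1.
- by move=> s s0; exact: nonlinearityB_le.
by rewrite le_eqVlt; apply/orP; left; apply/eqP; ring.
Qed.

End estimates.

(** * Elementary real analysis *)

(** Corrected by [2 * c / 2 ^ n], the sequence becomes nondecreasing with one sign
    and nonincreasing with the other; the limit lies between the two. *)
Lemma geometric_limit (R : realType) (x : nat -> R) (c : R) :
  (forall n, `|x n.+1 - x n| <= c / 2 ^+ n) ->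
  (x @ \oo --> limn x) /\ forall n, `|limn x - x n| <= 2 * c / 2 ^+ n.
Proof.
move=> xc.
have c0 : 0 <= c by have := xc 0%N; rewrite expr0 divr1; exact: le_trans.
have e0 n : 2 * c / 2 ^+ n.+1 = c / 2 ^+ n :> R.
  by rewrite exprS; field; rewrite expf_neq0.
pose y n := x n - 2 * c / 2 ^+ n; pose z n := x n + 2 * c / 2 ^+ n.
have half n : 2 * c / 2 ^+ n = c / 2 ^+ n + c / 2 ^+ n :> R by ring.
have cn0 n : 0 <= c / 2 ^+ n by rewrite divr_ge0// exprn_ge0.
have yinc : nondecreasing_seq y.
  apply/nondecreasing_seqP => n; rewrite /y e0 half.
  by have := xc n; rewrite ler_norml; lra.
have zdec : nonincreasing_seq z.
  apply/nonincreasing_seqP => n; rewrite /z e0 half.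
  by have := xc n; rewrite ler_norml; lra.
have yz n m : y n <= z m.
  have [nm|mn] := leqP n m.
    by apply: (le_trans (yinc _ _ nm)); rewrite /y /z half; have := cn0 m; lra.
  by apply: (le_trans _ (zdec _ _ (ltnW mn))); rewrite /y /z half; have := cn0 n; lra.
have cvy : cvgn y.
  by apply: nondecreasing_is_cvgn => //; exists (z 0%N) => _ [n _ <-].
have cv0 : (fun n => 2 * c / 2 ^+ n) @ \oo --> (0 : R).
  rewrite -[X in _ --> X](mulr0 (2 * c)); apply: cvgMr.
  under eq_fun do rewrite -exprVn.
  by apply: cvg_expr; rewrite ger0_norm ?invr_ge0// invf_lt1// ltr1n.
have cvx : x @ \oo --> limn y.
  rewrite -[X in _ --> X]addr0 (_ : x = (fun n => y n + 2 * c / 2 ^+ n)).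
    exact: cvgD.
  by apply/funext => n; rewrite /y subrK.
have -> : limn x = limn y by exact/cvg_lim.
split=> // n.
have h1 : y n <= limn y by exact: nondecreasing_cvgn_le.
have h2 : limn y <= z n by apply: limr_le => //; near=> m; exact: yz.
by move: h1 h2; rewrite /y /z ler_norml; lra.
Unshelve. all: by end_near. Qed.

Lemma le_geometric_le0 (R : realType) (x c : R) : (forall n, x <= c / 2 ^+ n) -> x <= 0.
Proof.
move=> xc; rewrite leNgt; apply/negP => x0.
have c0 : 0 < c by have := xc 0%N; rewrite expr0 divr1; exact: lt_le_trans.
have := archi_boundP (ltW (divr_gt0 c0 x0)).
set n := Num.bound _; rewrite ltr_pdivrMr// => cn.
have := xc n; rewrite ler_pdivlMr ?exprn_gt0// leNgt => /negP; apply.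
apply: (lt_le_trans cn); rewrite mulrC ler_pM2l// -natrX ler_nat.
exact: ltnW (ltn_expl _ _).
Qed.

Lemma expR_pow_le (R : realType) (y : R) N : 0 <= y -> y ^+ N * expR (- y) <= N%:R ^+ N.
Proof.
move=> y0; rewrite expRN ler_pdivrMr ?expR_gt0//.
case: N => [|N]; first by rewrite !expr0 mul1r -[leLHS]expR0 ler_expR.
have N0 : 0 < N.+1%:R :> R by rewrite ltr0n.
have -> : expR y = expR (y / N.+1%:R) ^+ N.+1.
  by rewrite -expRM_natr divfK// gt_eqF.
rewrite -exprMn lerXn2r ?nnegrE ?mulr_ge0 ?expR_ge0//.
rewrite -ler_pdivrMl// mulrC; apply: le_trans (expR_ge1Dx _).
by rewrite lerDr.
Qed.

Lemma rowB (V : zmodType) n (x y : 'rV[V]_n) k : (x - y) 0 k = x 0 k - y 0 k.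
Proof. by rewrite !mxE. Qed.

(** * The Picard iteration *)

Section picard.
Variables (R : realType) (M : 'I_3 -> 'I_3 -> 'I_3 -> Z3 -> R[i]).
Hypothesis hM : forall (i j k : 'I_3) (xi : Z3), cmod (M i j k xi) <= enorm R xi.
Variable C0 : R.
Hypothesis C0_gt0 : 0 < C0.
Hypothesis convC0 : forall xi : Z3,
  (\esum_(q in [set: Z3])
     ((snorm xi)%:R * ((snorm q)%:R ^- 2 * (snorm (xi - q))%:R ^- 2) : R)%:E <= C0%:E)%E.
Variable psi : Z3 -> 'rV[R[i]]_3.
(* [2304 = 16 * 144]: with [A = 2 * eps], [144 * C0 * A = 1 / 8], so that the
   ball of radius [A] is preserved, and [288 * C0 * A = 1 / 4] is a contraction
   constant. *)
Let eps : R := (2304 * C0)^-1.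
Hypothesis psi_small : forall xi k, cmod (psi xi 0 k) <= eps * (snorm xi)%:R ^- 2.

Local Notation field := (Z3 -> R -> 'rV[R[i]]_3).
Let A : R := 2 * eps.
Let Phi := @duhamel_map R M psi.

Definition picard n : field := iter n Phi (fun _ _ => 0).

Lemma picard_eps_gt0 : 0 < eps.
Proof.
by rewrite invr_gt0; apply: mulr_gt0; [rewrite ltr0n | exact: C0_gt0].
Qed.

Lemma picard_radius_ge0 : 0 <= A.
Proof. by rewrite mulr_ge0// ltW// picard_eps_gt0. Qed.
Local Notation A0 := picard_radius_ge0.

Lemma picard_radiusE : C0 * A = 1152^-1.
Proof. by rewrite /A /eps; field; rewrite gt_eqF. Qed.

Lemma bounded_byW a b (u : field) : a <= b -> bounded_by a u -> bounded_by b u.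
Proof.
move=> ab ua xi t k t0; apply: le_trans (ua xi t k t0) _.
by rewrite ler_wpM2r// gevrey_weight_ge0.
Qed.

Lemma bounded_by_distC a (u w : field) : bounded_by a (fun xi t => u xi t - w xi t) ->
  bounded_by a (fun xi t => w xi t - u xi t).
Proof.
move=> h xi t k t0; have := h xi t k t0.
by rewrite -cmodN !mxE opprB.
Qed.

Lemma picard_good n : bounded_by A (picard n) /\ time_measurable (picard n).
Proof.
elim: n => [|n [IH1 IH2]].
  split=> [xi t k t0|xi k T].
    by rewrite mxE cmod0 mulr_ge0 ?gevrey_weight_ge0 ?A0.
  rewrite (_ : (fun t => _) = fun=> 0); first exact: cmeasurable_cst.
  by apply/funext => t; rewrite mxE.
split; last exact: (duhamel_map_measurable hM C0_gt0 convC0 psi A0 IH1 IH2).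
apply: bounded_byW (duhamel_map_bounded hM C0_gt0 convC0 A0 IH1 IH2 psi_small).
rewrite expr2 mulrA -(mulrA 144) picard_radiusE /A; have := picard_eps_gt0; lra.
Qed.

Lemma picard_step n :
  bounded_by (A / 2 ^+ n) (fun xi t => picard n.+1 xi t - picard n xi t).
Proof.
elim: n => [|n IH].
  move=> xi t k t0; rewrite expr0 divr1 [picard 0%N]/picard /= subr0.
  by have [h _] := picard_good 1; exact: h.
have [b1 m1] := picard_good n.+1; have [b0 m0] := picard_good n.
have D0 : 0 <= A / 2 ^+ n by rewrite divr_ge0 ?A0// exprn_ge0.
apply: bounded_byW (duhamel_mapB_bounded hM C0_gt0 convC0 psi A0 D0 b1 b0 m1 m0 IH).
rewrite -(mulrA 288) picard_radiusE exprS.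
have -> : A / (2 * 2 ^+ n) = 1 / 2 * (A / 2 ^+ n) by field; rewrite expf_neq0.
by apply: ler_wpM2r => //; lra.
Qed.

Definition picard_limit : field := fun xi t => \row_k
  (limn (fun n => complex.Re (picard n xi t 0 k)) +i*
   limn (fun n => complex.Im (picard n xi t 0 k))).

Lemma picard_Re_step xi t k n : 0 <= t ->
  `|complex.Re (picard n.+1 xi t 0 k) - complex.Re (picard n xi t 0 k)| <=
  A * gevrey_weight (snorm xi) t / 2 ^+ n.
Proof.
move=> t0; have := picard_step n xi k t0; rewrite rowB -raddfB mulrAC.
exact: le_trans (Re_le_cmod _).
Qed.

Lemma picard_Im_step xi t k n : 0 <= t ->
  `|complex.Im (picard n.+1 xi t 0 k) - complex.Im (picard n xi t 0 k)| <=
  A * gevrey_weight (snorm xi) t / 2 ^+ n.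
Proof.
move=> t0; have := picard_step n xi k t0; rewrite rowB -raddfB mulrAC.
exact: le_trans (Im_le_cmod _).
Qed.

Lemma picard_limit_close n :
  bounded_by (4 * A / 2 ^+ n) (fun xi t => picard_limit xi t - picard n xi t).
Proof.
move=> xi t k t0; rewrite !mxE; apply: le_trans (cmod_le_ReIm _) _.
rewrite !raddfB /=.
have [_ /(_ n) hr] := geometric_limit (fun n => picard_Re_step xi k n t0).
have [_ /(_ n) hi] := geometric_limit (fun n => picard_Im_step xi k n t0).
apply: le_trans (lerD hr hi) _; rewrite le_eqVlt; apply/orP; left; apply/eqP; ring.
Qed.

Lemma picard_limit_bounded : bounded_by (4 * A) picard_limit.
Proof.
move=> xi t k t0; have := picard_limit_close 0 xi k t0.
by rewrite expr0 divr1 [picard 0%N]/picard /= subr0.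
Qed.

Lemma picard_limit_measurable : time_measurable picard_limit.
Proof.
move=> xi k T; split.
  apply: (@measurable_fun_cvg _ _ _ _ (fun n t => complex.Re (picard n xi t 0 k))) => [n|t].
    by have [_ /(_ xi k T) []] := picard_good n.
  rewrite /= in_itv /= mxE => /andP[t0 _] /=.
  by have [] := geometric_limit (fun n => picard_Re_step xi k n t0).
apply: (@measurable_fun_cvg _ _ _ _ (fun n t => complex.Im (picard n xi t 0 k))) => [n|t].
  by have [_ /(_ xi k T) []] := picard_good n.
rewrite /= in_itv /= mxE => /andP[t0 _] /=.
by have [] := geometric_limit (fun n => picard_Im_step xi k n t0).
Qed.

(** Both sides are within a multiple of [2 ^- n] of the iterate of rank [n + 1],
    the right-hand one because [Phi] is Lipschitz for the weighted norm: the
    limit is taken in the estimates, never under the sum or the integral. *)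
Lemma picard_limit_fixed xi t k : 0 <= t ->
  picard_limit xi t 0 k = Phi picard_limit xi t 0 k.
Proof.
move=> t0; apply/eqP; rewrite -subr_eq0; apply/eqP; apply: cmod_eq0.
pose c := (4 * A + 288 * C0 * (4 * A) * (4 * A)) * gevrey_weight (snorm xi) t.
apply: (@le_geometric_le0 _ _ c) => n.
have A40 : 0 <= 4 * A by rewrite mulr_ge0 ?A0.
have Dn0 : 0 <= 4 * A / 2 ^+ n by rewrite divr_ge0// exprn_ge0.
have [b m] := picard_good n.
have b4 : bounded_by (4 * A) (picard n).
  by apply: bounded_byW b; rewrite ler_peMl ?A0// ler1n.
have h := duhamel_mapB_bounded hM C0_gt0 convC0 psi A40 Dn0 b4 picard_limit_bounded
  m picard_limit_measurable (bounded_by_distC (picard_limit_close n)).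
have := picard_limit_close n.+1 xi k t0; rewrite rowB => h1.
have h2 : cmod (picard n.+1 xi t 0 k - Phi picard_limit xi t 0 k) <=
    288 * C0 * (4 * A) * (4 * A / 2 ^+ n) * gevrey_weight (snorm xi) t.
  by rewrite -rowB; exact: h.
rewrite -(subrKA (picard n.+1 xi t 0 k)).
apply: le_trans (cmodD _ _) _; apply: le_trans (lerD h1 h2) _.
rewrite -mulrDl /c [leRHS]mulrAC; apply: ler_wpM2r; first exact: gevrey_weight_ge0.
rewrite [leRHS]mulrDl; apply: lerD; last first.
  by rewrite le_eqVlt; apply/orP; left; apply/eqP; ring.
rewrite ler_wpM2l// exprS invfM ler_piMl ?invr_ge0 ?exprn_ge0//.
by rewrite invf_le1// ler1n.
Qed.

End picard.

(** * Properties that follow from the weighted bound *)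

Section from_bound.
Variable R : realType.
Implicit Types (A t T : R) (u : Z3 -> R -> 'rV[R[i]]_3).

Lemma enorm_sqr_cmod_le A u xi t k : 0 <= A -> bounded_by A u -> 0 <= t ->
  enorm R xi ^+ 2 * cmod (u xi t 0 k) <= 4 * A.
Proof.
move=> A0 uA t0.
have n2 : enorm R xi ^+ 2 <= 4 * (snorm xi)%:R ^+ 2.
  have := enorm_le_snorm R xi; have : 0 <= enorm R xi by exact: sqrtr_ge0.
  by nra.
apply: le_trans (ler_pM (sqr_ge0 _) (cmod_ge0 _) n2 (uA xi t k t0)) _.
rewrite /gevrey_weight mulrACA ler_piMr ?mulr_ge0//.
have [->|n0] := posnP (snorm xi).
  by rewrite expr0n mul0r.
rewrite mulrA divff ?mul1r ?decay_le1//.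
by rewrite expf_neq0// gt_eqF// ltr0n.
Qed.

Lemma bounded_by_Phi2_norm A u t : 0 <= A -> bounded_by A u -> 0 <= t ->
  (Phi2_norm (fun xi => u xi t) <= (4 * A)%:E)%E.
Proof.
move=> A0 uA t0; rewrite /Phi2_norm.
apply: (big_ind (fun x => (x <= (4 * A)%:E)%E)) => [|x y hx hy|k _].
- exact: leNye.
- by rewrite ge_max hx hy.
by apply: ge_ereal_sup => _ [xi _ <-]; rewrite lee_fin enorm_sqr_cmod_le.
Qed.

Lemma bounded_by_Phi2 A u t : 0 <= A -> bounded_by A u -> 0 <= t ->
  Phi2 (fun xi => u xi t).
Proof.
move=> A0 uA t0; split; last by apply: le_lt_trans (bounded_by_Phi2_norm A0 uA t0) (ltry _).
apply/rowP => k; rewrite mxE; apply: cmod_eq0; apply: le_trans (uA 0 t k t0) _.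
by rewrite (eqP (_ : snorm 0 == 0%N)) ?snorm_eq0// gevrey_weight0 mulr0.
Qed.

(** For [t >= rho] the exponential factor is at most
    [expR (- (snorm xi * rho / 2))], which beats every power of [snorm xi]
    ([expR_pow_le]). *)
Lemma bounded_by_smooth A u T : 0 <= A -> bounded_by A u -> smooth T u.
Proof.
move=> A0 uA rho N k /andP[rho0 _].
pose c : R := (4 / rho) ^+ N * N%:R ^+ N * A.
apply: (@le_lt_trans _ _ c%:E); last exact: ltry.
apply: ge_ereal_sup => _ [t /= + <-]; rewrite in_itv /= => /andP[rt _].
have t0 : 0 <= t := le_trans (ltW rho0) rt.
apply: ge_ereal_sup => _ [xi _ <-]; rewrite lee_fin.
set n : R := (snorm xi)%:R; have n0 : 0 <= n by exact: ler0n.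
have eN : enorm R xi ^+ N <= (2 * n) ^+ N.
  by rewrite lerXn2r ?nnegrE ?mulr_ge0 ?sqrtr_ge0// enorm_le_snorm.
apply: le_trans (ler_pM (exprn_ge0 _ (sqrtr_ge0 _)) (cmod_ge0 _) eN (uA xi t k t0)) _.
rewrite mulrCA /c [leRHS]mulrC ler_wpM2l//.
have wE : gevrey_weight (snorm xi) t <= expR (- (n / 2 * rho)).
  apply: (@le_trans _ _ (expR (- (n / 2 * t)))); last first.
    by rewrite ler_expR lerN2 ler_wpM2l// divr_ge0.
  rewrite /gevrey_weight ler_piMl ?expR_ge0//.
  have [->|xi0] := posnP (snorm xi); first by rewrite expr0n invr0 ler01.
  by rewrite invf_le1 ?exprn_gt0 ?ltr0n// exprn_ege1// ler1n.
apply: (@le_trans _ _ ((2 * n) ^+ N * expR (- (n / 2 * rho)))).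
  by rewrite ler_wpM2l ?exprn_ge0 ?mulr_ge0.
have -> : (2 * n) ^+ N = (4 / rho) ^+ N * (n / 2 * rho) ^+ N.
  by rewrite -exprMn; congr (_ ^+ _); field; rewrite gt_eqF.
rewrite -[leLHS]mulrA; apply: ler_wpM2l.
  by rewrite exprn_ge0// divr_ge0// ltW.
by apply: expR_pow_le; rewrite mulr_ge0 ?divr_ge0// ltW.
Qed.

Lemma Phi2_norm_pointwise (psi : Z3 -> 'rV[R[i]]_3) (e : R) xi k :
  Phi2 psi -> (Phi2_norm psi < e%:E)%E ->
  cmod (psi xi 0 k) <= e * (snorm xi)%:R ^- 2.
Proof.
move=> [psi0 _] psie; have [->|xi0] := eqVneq xi 0.
  by rewrite psi0 mxE cmod0 (eqP (_ : snorm 0 == 0%N)) ?snorm_eq0// expr0n invr0 mulr0.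
have n0 : 0 < (snorm xi)%:R ^+ 2 :> R by rewrite exprn_gt0// ltr0n snorm_gt0.
rewrite ler_pdivlMr// mulrC.
apply: (@le_trans _ _ (enorm R xi ^+ 2 * cmod (psi xi 0 k))).
  by rewrite ler_wpM2r ?cmod_ge0// snorm_sqr_le_enorm.
rewrite -lee_fin; apply: le_trans (ltW psie).
rewrite /Phi2_norm (bigD1 k)//= le_max; apply/orP; left.
by apply: ereal_sup_ubound; exists xi.
Qed.

End from_bound.

(** * Global regular solutions *)

Theorem theorem1 (R : realType) (M : 'I_3 -> 'I_3 -> 'I_3 -> Z3 -> R[i])
    (hM : forall (i j k : 'I_3) (xi : Z3), cmod (M i j k xi) <= enorm R xi) :
  exists eps : R, 0 < eps /\
    forall psi : Z3 -> 'rV[R[i]]_3,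
      Phi2 psi -> (Phi2_norm psi < eps%:E)%E ->
      exists v : Z3 -> R -> 'rV[R[i]]_3,
        forall T : R, 0 < T -> solution M psi T v /\ smooth T v.
Proof.
have [C0 C0_gt0 convC0] := convolution_bound R.
exists (2304 * C0)^-1; split; first exact: picard_eps_gt0.
move=> psi psi2 psie.
have psi_small xi k := Phi2_norm_pointwise xi k psi2 psie.
pose A := 4 * (2 * (2304 * C0)^-1).
have A0 : 0 <= A := mulr_ge0 (ler0n _ 4) (picard_radius_ge0 C0_gt0).
have vA := picard_limit_bounded hM C0_gt0 convC0 psi_small.
exists (picard_limit M psi) => T T0; split; last exact: bounded_by_smooth A0 vA.
split.
- move=> xi k.
  have [mr mi] := picard_limit_measurable hM C0_gt0 convC0 psi_small xi k T.
  by split; [apply: measurable_funS mr|apply: measurable_funS mi] => //;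
    exact: subset_itv_co_cc.
- by move=> t /andP[t0 _]; exact: bounded_by_Phi2 A0 vA t0.
- apply: (@le_lt_trans _ _ (4 * A)%:E); last exact: ltry.
  apply: ge_ereal_sup => _ [t /= + <-]; rewrite in_itv /= => /andP[t0 _].
  exact: bounded_by_Phi2_norm.
- move=> xi k t /andP[t0 _].
  by rewrite (picard_limit_fixed hM C0_gt0 convC0 psi_small xi k t0) mxE.
Qed.
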